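(* Let $(\mathbb{S},\Sigma)$ be a measurable space, let a sequence of measures $\{\mu_n\}_{n\ge 1}$ on $(\mathbb{S},\Sigma)$ converge setwise to a finite measure $\mu$, and let $\{f_n\}_{n\ge 1}$ be a sequence of $[-\infty,+\infty]$-valued measurable functions on $\mathbb{S}$ lower semi-converging to a measurable real-valued function $f$ in measure $\mu$. All integrals appearing in this statement are assumed to be defined. If there exists a sequence of measurable real-valued functions $\{g_n\}_{n\ge 1}$ on $\mathbb{S}$ such that $f_n(s)\ge g_n(s)$ for all $n\ge 1$ and $s\in\mathbb{S}$, and $$-\infty<\int_{\mathbb{S}}\limsup_{n\to\infty} g_n(s)\,\mu(ds)\le\liminf_{n\to\infty}\int_{\mathbb{S}} g_n(s)\,\mu_n(ds),$$ then $$\int_{\mathbb{S}} f(s)\,\mu(ds)\le\liminf_{n\to\infty}\int_{\mathbb{S}} f_n(s)\,\mu_n(ds).$$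
   Context: For a function $h$, $h^+=\max\{h,0\}$ and $h^-=-\min\{h,0\}$. The integral $\int h\,d\mu$ of a measurable $[-\infty,+\infty]$-valued function is defined if $\min\{\int h^+d\mu,\int h^-d\mu\}<+\infty$, and then equals $\int h^+d\mu-\int h^-d\mu$. Setwise convergence: $\mu_n(C)\to\mu(C)$ for every $C\in\Sigma$. Lower semi-convergence in measure: measurable functions $f_n$ lower semi-converge to a measurable real-valued $f$ in measure $\mu$ if for each $\varepsilon>0$, $\mu(\{s: f_n(s)\le f(s)-\varepsilon\})\to 0$ as $n\to\infty$. *)

(* Defs.v *)
From HB Require Import structures.
From mathcomp Require Export all_boot all_order all_algebra.
From mathcomp Require Export all_classical all_reals all_analysis measurable_realfun.
Export Order.TTheory GRing.Theory Num.Theory.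
Export numFieldNormedType.Exports.

Set Implicit Arguments.
Unset Strict Implicit.
Unset Printing Implicit Defensive.

Local Open Scope classical_set_scope.
Local Open Scope ring_scope.
Local Open Scope ereal_scope.

(* The library integral is total, with +oo - +oo = -oo; this predicate says
   that the difference defining the integral of h is not of that form. *)
Definition integral_defined d (T : measurableType d) (R : realType)
    (mu : {measure set T -> \bar R}) (h : T -> \bar R) : Prop :=
  mine (\int[mu]_s h^\+ s) (\int[mu]_s h^\- s) < +oo.

Definition setwise_cvg d (T : measurableType d) (R : realType)
    (mu_ : nat -> {measure set T -> \bar R})
    (mu : {measure set T -> \bar R}) : Prop :=
  forall C : set T, measurable C -> mu_ n C @[n --> \oo] --> mu C.

Definition lower_semicvg_in_measure d (T : measurableType d) (R : realType)
    (mu : {measure set T -> \bar R})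
    (f_ : nat -> T -> \bar R) (f : T -> R) : Prop :=
  forall eps : R, (0 < eps)%R ->
    mu [set s | f_ n s <= (f s - eps)%:E] @[n --> \oo] --> 0.

(* Main.v *)
(* Suppose c < \int f dmu and \int f_n dmu_n < c for infinitely many n. By
   Borel-Cantelli there are such indices n_k -> oo with f <= liminf_k f_(n_k)
   mu-a.e. Let G = limsup_n g_n; if \int G dmu = +oo, then \int g_n dmu_n -> +oo,
   which is absurd since g_n <= f_n; otherwise G is mu-integrable. The functions
   p_k = f_(n_k) - g_(n_k) are nonnegative and f <= liminf_k p_k + G a.e., so
   Fatou's lemma for setwise converging measures, applied to p_k, gives
   \int f dmu <= liminf_k \int p_k dmu_(n_k) + liminf_n \int g_n dmu_n, which is
   at most c because the two integrals add up to \int f_(n_k) dmu_(n_k). *)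
Require Import Defs.
From mathcomp Require Import lra.

Set Implicit Arguments.
Unset Strict Implicit.
Unset Printing Implicit Defensive.

Local Open Scope classical_set_scope.
Local Open Scope ring_scope.
Local Open Scope ereal_scope.

(** * Lower and upper limits in the extended reals *)

Lemma lee_ltfin (R : realType) (x y : \bar R) :
  (forall r : R, r%:E < x -> r%:E <= y) -> x <= y.
Proof.
case: x => [x| |] xy; last exact: leNye.
- apply/lee_subgt0Pr => e e0; rewrite -EFinB; apply: xy.
  by rewrite lte_fin ltrBlDr ltrDl.
- case: y xy => [y| |] // /(_ _ (ltry _)) => [/(_ (y + 1)%R)|/(_ 0%R)] //.
  by rewrite lee_fin gerDl leNgt ltr01.
Qed.

Lemma limn_einf_gt (R : realType) (u : (\bar R)^nat) (a : \bar R) :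
  a < limn_einf u -> \forall n \near \oo, a < u n.
Proof.
rewrite -[limn_einf u]/(limf_einf u \oo) limf_einfE.
move=> /ereal_sup_gt[_ [V ooV <-] aV].
apply: filterS ooV => n Vn; apply: lt_le_trans aV _.
by apply: ereal_inf_lbound; exists n.
Qed.

Lemma limn_esup_lt (R : realType) (u : (\bar R)^nat) (a : \bar R) :
  limn_esup u < a -> \forall n \near \oo, u n < a.
Proof.
rewrite -lteN2 -limn_einfN => /limn_einf_gt.
by apply: filterS => n /=; rewrite lteN2.
Qed.

(** Testing only against real [r] reduces every lower bound on a lower limit to a real estimate,
    also when [x] is infinite. *)
Lemma limn_einf_ge (R : realType) (u : (\bar R)^nat) (x : \bar R) :
  (forall r : R, r%:E < x -> \forall n \near \oo, r%:E <= u n) ->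
  x <= limn_einf u.
Proof.
move=> xu; apply: lee_ltfin => r /xu ru.
rewrite -[limn_einf u]/(limf_einf u \oo) limf_einfE.
apply: ereal_sup_ge; exists (ereal_inf (u @` [set n | r%:E <= u n])).
  by exists [set n | r%:E <= u n].
by apply: le_ereal_inf_tmp => _ [n run <-].
Qed.

Lemma measurable_fun_limn_einf d (T : measurableType d) (R : realType)
    (D : set T) (f : (T -> \bar R)^nat) :
  (forall n, measurable_fun D (f n)) ->
  measurable_fun D (fun x => limn_einf (f ^~ x)).
Proof.
move=> mf; rewrite /limn_einf; apply: measurableT_comp => //.
by apply: measurable_fun_limn_esup => n; exact: measurableT_comp.
Qed.

(** Positive parts grow and negative parts shrink, and subtraction of the two integrals stays
    monotone even with +oo - +oo = -oo. *)
Lemma ae_le_integral d (T : measurableType d) (R : realType)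
    (mu : {measure set T -> \bar R}) (f g : T -> \bar R) :
  measurable_fun [set: T] f -> measurable_fun [set: T] g ->
  {ae mu, forall x, f x <= g x} -> \int[mu]_x f x <= \int[mu]_x g x.
Proof.
move=> mf mg fg; rewrite integralE [leRHS]integralE.
apply: leeB; apply: ae_ge0_le_integral => //;
  try exact: measurable_funepos; try exact: measurable_funeneg;
  apply: filterS fg => x fgx _.
  by rewrite !funeposE ge_max le_max fgx/= le_max lexx orbT.
by rewrite !funenegE ge_max le_max leeN2 fgx/= le_max lexx orbT.
Qed.

(** * Fatou's lemma for setwise converging measures, and additivity of the integral *)

Import HBNNSimple.

(** The integral is a finite combination, with nonnegative terms, of the measures of the level sets
    of [h]. *)
Lemma setwise_cvg_sintegral d (T : measurableType d) (R : realType)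
    (mu_ : nat -> {measure set T -> \bar R}) (mu : {measure set T -> \bar R})
    (h : {nnsfun T >-> R}) :
  setwise_cvg mu_ mu -> sintegral (mu_ n) h @[n --> \oo] --> sintegral mu h.
Proof.
have sintegralE_seq (m : {measure set T -> \bar R}) : sintegral m h =
    \sum_(x <- finmap.enum_fset (fset_set (range h))) x%:E * m (h @^-1` [set x]).
  by rewrite sintegralE fsbig_finite.
move=> mu_cvg; rewrite sintegralE_seq; under eq_fun do rewrite sintegralE_seq.
apply: cvg_nnesum => x _; first by apply: nearW => n; exact: nnsfun_mulemu_ge0.
by apply: cvgeZl => //; exact: mu_cvg.
Qed.

(** The tail infima [q k] increase to the lower limit, so by monotone convergence it is enough to
    bound the integral of each [q k]. *)
Lemma setwise_fatou d (T : measurableType d) (R : realType)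
    (mu_ : nat -> {measure set T -> \bar R}) (mu : {measure set T -> \bar R})
    (f_ : nat -> T -> \bar R) :
  setwise_cvg mu_ mu -> (forall n, measurable_fun [set: T] (f_ n)) ->
  (forall n x, 0 <= f_ n x) ->
  \int[mu]_x limn_einf (f_ ^~ x) <= limn_einf (fun n => \int[mu_ n]_x f_ n x).
Proof.
move=> mu_cvg mf f0.
pose q k x := einfs (f_ ^~ x) k.
have mq k : measurable_fun [set: T] (q k) by exact: measurable_fun_einfs.
have q0 k x : 0 <= q k x by apply: le_ereal_inf_tmp => _ [m /= _ <-].
have q_nd x : {homo q ^~ x : m n / (m <= n)%N >-> m <= n}.
  move=> m n mn; apply: ereal_inf_le_tmp => _ /= [p /= np <-].
  by exists p => //=; rewrite (leq_trans mn).
under eq_integral do rewrite limn_einf_lim.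
rewrite (@monotone_convergence _ _ _ mu _ measurableT q)//.
apply: lime_le.
  apply: ereal_nondecreasing_is_cvgn => m n mn; apply: ge0_le_integral => //.
  by move=> x _; exact: q_nd.
apply: nearW => k; apply: limn_einf_ge => r.
(* Here [k] is fixed. A simple [h <= q k] whose [mu]-integral exceeds [r] also has [mu_ n]-integral
   above [r] for large [n], and [h <= q k <= f_ n] once [n >= k]. *)
rewrite ge0_integralTE// => /ereal_sup_gt[_ [h hq <-] rh].
have : \forall n \near \oo, r%:E < sintegral (mu_ n) h.
  have := @setwise_cvg_sintegral _ _ _ _ _ h mu_cvg.
  by move=> /(_ _ (open_ereal_gt' rh)).
move=> rhn; near=> n.
have /ltW/le_trans : r%:E < sintegral (mu_ n) h by near: n.
apply; apply: (@le_trans _ _ (\int[mu_ n]_x q k x)).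
  by rewrite ge0_integralTE//; apply: ereal_sup_ubound; exists h.
apply: ge0_le_integral => // x _; apply: ereal_inf_lbound; exists n => //=.
by near: n; exact: nbhs_infty_ge.
Unshelve. all: by end_near. Qed.

(* Obtained by integrating p + g^+ + (p + g)^- = (p + g)^+ + g^-, an identity
   between sums of nonnegative functions. *)
Lemma integralD_ge0l d (T : measurableType d) (R : realType)
    (mu : {measure set T -> \bar R}) (p : T -> \bar R) (g : T -> R) :
  measurable_fun [set: T] p -> measurable_fun [set: T] g ->
  (forall x, 0 <= p x) -> -oo < \int[mu]_x (g x)%:E ->
  \int[mu]_x (p x + (g x)%:E) = \int[mu]_x p x + \int[mu]_x (g x)%:E.
Proof.
move=> mp mg p0; pose G x := (g x)%:E; pose F x := p x + G x.
rewrite -/(\int[mu]_x G x) -/(\int[mu]_x F x).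
have mG : measurable_fun [set: T] G by exact/measurable_EFinP.
have mF : measurable_fun [set: T] F by exact: emeasurable_funD.
rewrite (integralE mu _ G) (integralE mu _ F) => G_gt.
have [mFp mFn] := (measurable_funepos mF, measurable_funeneg mF).
have [mGp mGn] := (measurable_funepos mG, measurable_funeneg mG).
have Gn_lt : \int[mu]_x G^\- x < +oo.
  by rewrite ltey; apply: contraTneq G_gt => ->; rewrite addeNy ltxx.
(* Since [F >= G]; together with [Gn_lt] this makes both negative parts finite, so they can be moved
   across [key]. *)
have FG : \int[mu]_x F^\- x <= \int[mu]_x G^\- x.
  apply: ge0_le_integral => // x _.
  rewrite !funenegE ge_max !le_max lexx orbT andbT leeN2 /F.
  by rewrite leeDr// p0.
have key : \int[mu]_x p x + \int[mu]_x G^\+ x + \int[mu]_x F^\- x =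
           \int[mu]_x F^\+ x + \int[mu]_x G^\- x.
  rewrite -!ge0_integralD//; last 2 first.
  - by move=> x _; rewrite adde_ge0.
  - by apply: emeasurable_funD.
  apply: eq_integral => x _; rewrite !funeposE !funenegE /F /G.
  case: (p x) (p0 x) => [r| |]//= r0.
    rewrite -(EFinD r (g x)) -!EFin_max -!EFinD; congr EFin.
    by case: (lerP (g x) 0); case: (lerP (- g x)%R 0%R);
      case: (lerP (r + g x)%R 0%R); case: (lerP (- (r + g x))%R 0%R); lra.
  by rewrite -[+oo + (g x)%:E]/(+oo) maxNye maxye -!EFin_max.
have Fp0 : 0 <= \int[mu]_x F^\+ x by exact: integral_ge0.
have Fn0 : 0 <= \int[mu]_x F^\- x by exact: integral_ge0.
have Gp0 : 0 <= \int[mu]_x G^\+ x by exact: integral_ge0.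
have Gn0 : 0 <= \int[mu]_x G^\- x by exact: integral_ge0.
have P0 : 0 <= \int[mu]_x p x by exact: integral_ge0.
move: key FG Gn_lt Fp0 Fn0 Gp0 Gn0 P0.
move: (\int[mu]_x F^\+ x) (\int[mu]_x F^\- x) (\int[mu]_x G^\+ x)
      (\int[mu]_x G^\- x) (\int[mu]_x p x).
move=> [a| |] [b| |] [u| |] [v| |] [w| |]//= [] *; congr EFin; lra.
Qed.

(** * Almost everywhere lower bounds along a subsequence *)

Lemma borel_cantelli_near d (T : measurableType d) (R : realType)
    (mu : {measure set T -> \bar R}) (B : (set T)^nat) :
  (forall k, measurable (B k)) ->
  \sum_(k <oo) mu (B k) < +oo ->
  {ae mu, forall x, \forall k \near \oo, ~ B k x}.
Proof.
move=> mB Boo; exists (lim_sup_set B); split.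
- by apply: bigcap_measurable => // n _; exact: bigcup_measurable.
- exact: lim_sup_set_cvg0.
- move=> x /= nBx n _; apply: contrapT => nx; apply: nBx.
  by exists n => // k /= nk Bkx; apply: nx; exists k.
Qed.

(** As +oo - +oo is -oo, a finite difference forces both parts to have finite integral. *)
Lemma integral_fin_num_integrable d (T : measurableType d) (R : realType)
    (mu : {measure set T -> \bar R}) (f : T -> \bar R) :
  measurable_fun [set: T] f -> \int[mu]_x f x \is a fin_num ->
  mu.-integrable [set: T] f.
Proof.
move=> mf; rewrite integralE => ffin; apply/integrableP; split => //.
under eq_integral do rewrite -[`|f _|]/((abse \o f) _) fune_abse.
rewrite ge0_integralD//; [|exact: measurable_funepos|exact: measurable_funeneg].
have : 0 <= \int[mu]_x f^\+ x by exact: integral_ge0.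
have : 0 <= \int[mu]_x f^\- x by exact: integral_ge0.
move: ffin; move: (\int[mu]_x f^\+ x) (\int[mu]_x f^\- x).
by move=> [a| |] [b| |]//= _ _ _; rewrite -EFinD ltry.
Qed.

Lemma lower_semicvg_subseq d (T : measurableType d) (R : realType)
    (mu : {measure set T -> \bar R}) (f_ : nat -> T -> \bar R) (f : T -> R)
    (P : nat -> Prop) :
  (forall n, measurable_fun [set: T] (f_ n)) -> measurable_fun [set: T] f ->
  lower_semicvg_in_measure mu f_ f ->
  (forall N, exists2 n, (N <= n)%N & P n) ->
  exists n_ : nat -> nat, [/\ n_ k @[k --> \oo] --> \oo, forall k, P (n_ k) &
    {ae mu, forall x, (f x)%:E <= limn_einf (fun k => f_ (n_ k) x)}].
Proof.
move=> mf_ mf f_cvg Pfreq.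
(* [e k] is both the gap below [f] and the bound on the measure of the bad set: it tends to 0 and
   its sum is at most 1, as Borel-Cantelli requires. *)
pose e k : R := (1 / (2 ^ k.+1)%:R)%R.
have e0 k : (0 < e k)%R by rewrite divr_gt0// ltr0n expn_gt0.
pose B k n := [set x | f_ n x <= (f x - e k)%:E].
have mB k n : measurable (B k n).
  rewrite -[B k n]setTI; apply: measurable_lee => //.
  by apply/measurable_EFinP; exact: measurable_funB.
have /choice[n_ n_P] k : exists n,
    [/\ (k <= n)%N, P n & mu (B k n) <= (e k)%:E].
  have [N _ muN] : \forall n \near \oo, mu (B k n) < (e k)%:E.
    by have /(_ _ (open_ereal_lt' _)) := f_cvg _ (e0 k); apply; rewrite lte_fin.
  (* The bound [k <= n] alone makes [n_] tend to infinity; [n_] may fail to be increasing. *)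
  have [n] := Pfreq (maxn k N); rewrite geq_max => /andP[kn Nn] Pn.
  by exists n; split => //; exact/ltW/muN.
exists n_; split.
- move=> A [N _ NA]; exists N => // k /= Nk; apply: NA => /=.
  by have [kn _ _] := n_P k; exact: leq_trans Nk kn.
- by move=> k; have [] := n_P k.
- have : {ae mu, forall x, \forall k \near \oo, ~ B k (n_ k) x}.
    apply: borel_cantelli_near => //.
    apply: (@le_lt_trans _ _ 1%:E); last exact: ltry.
    apply: le_trans (epsilon_trick0 xpredT (@ler01 R)).
    by apply: lee_nneseries => // k _; have [] := n_P k.
  apply: filterS => x nB; apply: limn_einf_ge => r; rewrite lte_fin => rf.
  have ek : \forall k \near \oo, (e k < f x - r)%R.
    have : (geometric (1 / 2) (1 / 2) k @[k --> \oo] --> (0 : R))%R.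
      by apply: cvg_geometric; rewrite ger0_norm//; lra.
    move=> /cvgr_lt/(_ (f x - r)%R); rewrite subr_gt0 => /(_ rf).
    apply: filterS => k; congr (_ < _)%R.
    by rewrite /geometric /= /e natrX exprS expr_div_n expr1n mulf_div mulr1.
  near=> k.
  have ekr : (e k < f x - r)%R by near: k.
  have : ~ B k (n_ k) x by near: k.
  move=> /negP; rewrite -ltNge => /ltW; apply: le_trans.
  by rewrite lee_fin; lra.
Unshelve. all: by end_near. Qed.

(** Passing to [n_] cannot raise the upper limit of [v]. It is used pointwise, with [f_] along the
    subsequence as [u] and [g_] as [v]. *)
Lemma limn_einfB_ge (R : realType) (u : (\bar R)^nat) (v : R^nat)
    (n_ : nat -> nat) (a b : R) :
  n_ k @[k --> \oo] --> \oo ->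
  a%:E <= limn_einf u -> limn_esup (fun n => (v n)%:E) = b%:E ->
  (a - b)%:E <= limn_einf (fun k => u k - (v (n_ k))%:E).
Proof.
move=> n_oo au vb; apply: limn_einf_ge => r; rewrite lte_fin => rab.
(* Half the gap, so that (a - e) - (b + e) = r. *)
pose e := ((a - b - r) / 2)%R.
have ue : \forall k \near \oo, (a - e)%:E < u k.
  by apply: limn_einf_gt; apply: lt_le_trans au; rewrite lte_fin /e; lra.
have ve : \forall k \near \oo, (v (n_ k))%:E < (b + e)%:E.
  apply: (n_oo [set n | (v n)%:E < (b + e)%:E]); apply: limn_esup_lt.
  by rewrite vb lte_fin /e; lra.
near=> k.
have uk : (a - e)%:E < u k by near: k.
have : (v (n_ k))%:E < (b + e)%:E by near: k.
case: (u k) uk => [s| |]//=; rewrite ?leey// -EFinB !lte_fin lee_fin.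
by rewrite /e; lra.
Unshelve. all: by end_near. Qed.

(** * Fatou's lemma applied to the differences of [f_] and [g_] *)

Theorem corollary4p5 (R : realType) (d : measure_display)
    (S : measurableType d)
    (mu_ : nat -> {measure set S -> \bar R})
    (mu : {finite_measure set S -> \bar R})
    (f_ : nat -> S -> \bar R) (f : S -> R)
    (mu_cvg : setwise_cvg mu_ mu)
    (f_meas_ : forall n, measurable_fun [set: S] (f_ n))
    (f_meas : measurable_fun [set: S] f)
    (f_cvg : lower_semicvg_in_measure mu f_ f)
    (f_int_ : forall n, integral_defined (mu_ n) (f_ n))
    (f_int : integral_defined mu (fun s => (f s)%:E))
    (minorant : exists g_ : nat -> S -> R,
      [/\ forall n, measurable_fun [set: S] (g_ n),
          forall n s, (g_ n s)%:E <= f_ n s,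
          forall n, integral_defined (mu_ n) (fun s => (g_ n s)%:E),
          integral_defined mu (fun s => limn_esup (fun n => (g_ n s)%:E))
        & -oo < \int[mu]_s limn_esup (fun n => (g_ n s)%:E)
              <= limn_einf (fun n => \int[mu_ n]_s (g_ n s)%:E)]) :
  \int[mu]_s (f s)%:E <= limn_einf (fun n => \int[mu_ n]_s f_ n s).
Proof.
have [g_ [mg gf _ _ /andP[G_gt G_le]]] := minorant.
pose G s := limn_esup (fun n => (g_ n s)%:E).
rewrite -/(\int[mu]_s G s) in G_gt G_le.
have mg_ n : measurable_fun [set: S] (fun s => (g_ n s)%:E).
  exact/measurable_EFinP.
have mG : measurable_fun [set: S] G by exact: measurable_fun_limn_esup.
apply: limn_einf_ge => c cf.
have [G_infty|G_fin] := eqVneq (\int[mu]_s G s) +oo.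
  have : \forall n \near \oo, c%:E < \int[mu_ n]_s (g_ n s)%:E.
    by apply: limn_einf_gt; apply: lt_le_trans G_le; rewrite G_infty ltry.
  apply: filterS => n /ltW/le_trans; apply.
  by apply: ae_le_integral => //; exact: aeW.
apply: contrapT => not_near.
have [|n_ [n_oo n_lt f_le]] := @lower_semicvg_subseq _ _ _ mu f_ f
    (fun n => \int[mu_ n]_s f_ n s < c%:E) f_meas_ f_meas f_cvg.
  move=> N; apply: contrapT => no; apply: not_near; exists N => // n /= Nn.
  by rewrite leNgt; apply/negP => nc; apply: no; exists n.
have {}G_fin : \int[mu]_s G s \is a fin_num by rewrite fin_real// G_gt ltey.
have G_int := integral_fin_num_integrable mG G_fin.
(* A real-valued version of [G], as [integralD_ge0l] requires; it differs from [G] only on the null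
   set where [G] is infinite. *)
pose g0 s := fine (G s).
have mg0 : measurable_fun [set: S] g0 by exact: measurableT_comp.
have g0G : {ae mu, forall s, (g0 s)%:E = G s}.
  by apply: filterS (integrable_ae measurableT G_int) => s /(_ I) /fineK.
have int_g0 : \int[mu]_s (g0 s)%:E = \int[mu]_s G s.
  apply: ae_eq_integral => //; first exact/measurable_EFinP.
  by apply: filterS g0G => s + _.
pose p_ k s := f_ (n_ k) s - (g_ (n_ k) s)%:E.
have p0 k s : 0 <= p_ k s by rewrite /p_ sube_ge0 ?gf ?orbT.
have mp k : measurable_fun [set: S] (p_ k) by exact: emeasurable_funB.
pose H s := limn_einf (p_ ^~ s).
have mH : measurable_fun [set: S] H by exact: measurable_fun_limn_einf.
have H0 s : 0 <= H s.
  apply: limn_einf_ge => r /ltW r0.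
  by apply: nearW => k; exact: le_trans r0 _.
have fHg0 : {ae mu, forall s, (f s)%:E <= H s + (g0 s)%:E}.
  apply: filterS2 f_le g0G => s fs gs.
  rewrite -leeBlDr// -EFinB.
  exact: (limn_einfB_ge (v := g_ ^~ s) n_oo fs (esym gs)).
have : \int[mu]_s (f s)%:E <= \int[mu]_s H s + \int[mu]_s G s.
  rewrite -int_g0 -integralD_ge0l// ?int_g0//; apply: ae_le_integral => //.
    exact/measurable_EFinP.
  by apply: emeasurable_funD => //; exact/measurable_EFinP.
move=> /(lt_le_trans cf); rewrite -lteBlDr// => cH.
(* The real [a] splits [c] as a + (c - a), giving separate eventual bounds for the integrals of [p_]
   and [g_]. If the integral of [H] is +oo, any real above the left end works. *)
have [a /andP[ca aH]] : exists a : R,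
    c%:E - \int[mu]_s G s < a%:E < \int[mu]_s H s.
  move: cH; rewrite -(fineK G_fin) -EFinB; case: (\int[mu]_s H s) => [h| |]//.
    rewrite lte_fin => /midf_lt[ca ah].
    by eexists; rewrite !lte_fin; apply/andP; split; [exact: ca|exact: ah].
  move=> _; eexists; rewrite ltry andbT lte_fin.
  by apply: ltr_pwDr; [exact: ltr01|exact: lexx].
have muk : setwise_cvg (fun k => mu_ (n_ k)) mu.
  by move=> C mC; exact: (cvg_comp _ _ n_oo (mu_cvg C mC)).
have : \forall k \near \oo, a%:E < \int[mu_ (n_ k)]_s p_ k s.
  by apply: limn_einf_gt; apply: lt_le_trans aH _; exact: setwise_fatou.
have : \forall k \near \oo, (c - a)%:E < \int[mu_ (n_ k)]_s (g_ (n_ k) s)%:E.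
  apply: (n_oo [set n | (c - a)%:E < \int[mu_ n]_s (g_ n s)%:E]).
  apply: limn_einf_gt; apply: lt_le_trans G_le.
  by rewrite EFinB lteBlDr// addeC -lteBlDr.
move=> /filterI /[apply] -[k _ /(_ k (leqnn k)) [gk pk]].
have := n_lt k; apply/negP; rewrite -leNgt.
have -> : \int[mu_ (n_ k)]_s f_ (n_ k) s =
          \int[mu_ (n_ k)]_s (p_ k s + (g_ (n_ k) s)%:E).
  by apply: eq_integral => s _; rewrite /p_ subeK.
(* [gk] bounds the integral of [g_ (n_ k)] below by a real number, so it is not -oo. *)
rewrite integralD_ge0l//; last exact: le_lt_trans (leNye _) gk.
by rewrite -[c](subrKC a) EFinD; exact/ltW/lteD.
Qed.
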